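(* Let $A\in\mathbb{R}^{m\times n}$ have nonzero rows $a_1^\top,\dots,a_m^\top$ with $\operatorname{rank}(A)\ge2$, let $b\in\mathbb{R}^m$ be such that the linear system $Ax=b$ is consistent, and let $x^0\in\mathbb{R}^n$ be an arbitrary initial vector. Put $x_*^0=A^\dagger b+(I-A^\dagger A)x^0$. Let $\{x^k\}$ be generated by the AmPRDR method (see context). Then for every $k\ge1$ such that $x^k$ is not a solution of $Ax=b$ (so that $x^{k+1}$ is defined): (i) if the indices are selected by Strategy I, then $$\mathbb{E}\left[\|x^{k+1}-x_*^0\|_2^2\mid x^k\right]\le(1-\gamma_k)\left(1-\frac{\sigma_{\min}^2(M^{1/2}A)}{\|A\|_F^2}\right)\|x^k-x_*^0\|_2^2;$$ (ii) if the indices are selected by Strategy II, then $$\mathbb{E}\left[\|x^{k+1}-x_*^0\|_2^2\mid x^k\right]\le(1-\gamma_k)\left(1-2\frac{\sigma_{\min}^2(N^{1/2}A)}{\|A\|_F^4-\|AA^\top\|_F^2}\right)\|x^k-x_*^0\|_2^2.$$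
   Context: Notation: $[m]=\{1,\dots,m\}$; $A^\dagger$ is the Moore–Penrose pseudoinverse; $\|\cdot\|_F$ is the Frobenius norm; $\sigma_{\min}(B)$ is the smallest nonzero singular value of a matrix $B$; $A_{\mathcal S}$ is the row submatrix of $A$ indexed by $\mathcal S\subseteq[m]$. For $i\in[m]$, $\mathcal{H}_i=\{x\in\mathbb{R}^n:\langle a_i,x\rangle=b_i\}$ and $\mathcal{R}_{\mathcal{H}_i}(x)=x-2\frac{\langle a_i,x\rangle-b_i}{\|a_i\|_2^2}a_i$. Strategy I (without-replacement sampling): $\mathbb{P}(i_{k_1}=i)=\frac{\|a_i\|_2^2}{\|A\|_F^2}$ for $i\in[m]$ and, given $i_{k_1}$, $\mathbb{P}(i_{k_2}=j)=\frac{\|a_j\|_2^2}{\|A\|_F^2-\|a_{i_{k_1}}\|_2^2}$ for $j\ne i_{k_1}$. Strategy II (volume sampling): the two-element set $\mathcal{S}_k=\{i_{k_1},i_{k_2}\}\subseteq[m]$ satisfies $\mathbb{P}(\mathcal{S}_k=\mathcal{S})=\frac{\det(A_{\mathcal S}A_{\mathcal S}^\top)}{\sum_{\mathcal J}\det(A_{\mathcal J}A_{\mathcal J}^\top)}$ for every two-element $\mathcal S\subseteq[m]$, where $\mathcal J$ ranges over all two-element subsets of $[m]$; the order in which the two elements are labelled $i_{k_1},i_{k_2}$ is arbitrary. AmPRDR method (with a fixed choice of Strategy I or II; all draws are independent of the past). Initial step: draw $(i_{0_1},i_{0_2})$ repeatedly until $z^0=\mathcal{R}_{\mathcal{H}_{i_{0_2}}}\mathcal{R}_{\mathcal{H}_{i_{0_1}}}(x^0)\ne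 x^0$, and set $x^1=\frac12x^0+\frac12z^0$. For $k\ge1$: draw $(i_{k_1},i_{k_2})$ repeatedly until $z^k=\mathcal{R}_{\mathcal{H}_{i_{k_2}}}\mathcal{R}_{\mathcal{H}_{i_{k_1}}}(x^k)\ne x^k$ (possible as long as $x^k$ is not a solution; thus the accepted pair has the sampling distribution conditioned on $z^k\ne x^k$), and set $$x^{k+1}=(1-\alpha_k)x^k+\alpha_kz^k+\beta_k(x^k-x^{k-1}),$$ where, with $u_k=\frac{\langle a_{i_{k_1}},x^k\rangle-b_{i_{k_1}}}{\|a_{i_{k_1}}\|_2^2}$, $v_k=\frac{\langle a_{i_{k_2}},x^k\rangle-b_{i_{k_2}}-2\langle a_{i_{k_2}},a_{i_{k_1}}\rangle u_k}{\|a_{i_{k_2}}\|_2^2}$ and $w_k=u_ka_{i_{k_1}}+v_ka_{i_{k_2}}$ (so $z^k=x^k-2w_k$), $$\alpha_k=\frac{\|x^k-x^{k-1}\|_2^2\left(\langle w_k,x^k\rangle-(u_kb_{i_{k_1}}+v_kb_{i_{k_2}})\right)}{2\left(\|x^k-x^{k-1}\|_2^2\|w_k\|_2^2-\langle w_k,x^k-x^{k-1}\rangle^2\right)},\qquad \beta_k=\frac{\langle w_k,x^k-x^{k-1}\rangle\left(\langle w_k,x^k\rangle-(u_kb_{i_{k_1}}+v_kb_{i_{k_2}})\right)}{\|x^k-x^{k-1}\|_2^2\|w_k\|_2^2-\langle w_k,x^k-x^{k-1}\rangle^2}.$$ (The denominators are nonzero for $k\ge1$.) $\mathbb{E}[\cdot\mid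 x^k]$ denotes expectation over the index selection at iteration $k$, the preceding iterates $x^{k-1},x^k$ being fixed. Quantity $\gamma_k$ ($k\ge1$): let $\mathcal{Q}_k=\{(i,j)\in[m]^2:\mathcal{R}_{\mathcal{H}_j}\mathcal{R}_{\mathcal{H}_i}(x^k)\ne x^k\}$. For $(i,j)\in\mathcal{Q}_k$ put $z^k=\mathcal{R}_{\mathcal{H}_j}\mathcal{R}_{\mathcal{H}_i}(x^k)$, $\tilde x^{k+1}=\frac12x^k+\frac12z^k$ and $$\zeta_k=\langle z^k-x^k,x^k-x^{k-1}\rangle(z^k-x^k)-\|z^k-x^k\|_2^2(x^k-x^{k-1}),$$ and let $\theta_k$ (depending on $(i,j)$) be the angle between $\tilde x^{k+1}-x_*^0$ and $\zeta_k$, with the convention $\cos\theta_k=0$ if $\tilde x^{k+1}=x_*^0$. Then $\gamma_k=\inf_{(i,j)\in\mathcal{Q}_k}\cos^2\theta_k$. Matrix $M\in\mathbb{R}^{m\times m}$: with $\Delta=\sum_{j=1}^m\frac{\|a_j\|_2^2}{\|A\|_F^2-\|a_j\|_2^2}$, set $M_{ii}=\Delta+1-\frac{\|a_i\|_2^2}{\|A\|_F^2-\|a_i\|_2^2}$ and $M_{ij}=-\frac{2\langle a_i,a_j\rangle}{\|A\|_F^2-\|a_j\|_2^2}$ for $i\ne j$. One has $y^\top My>0$ for all $y\ne0$. $M^{1/2}$ denotes the symmetric positive definite square root of the symmetric part $\frac12(M+M^\top)$, so that $\|M^{1/2}y\|_2^2=y^\top My$ for all $y\in\mathbb{R}^m$.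 Matrix $N\in\mathbb{R}^{m\times m}$: with $g_{i,j}=1-\frac{\langle a_i,a_j\rangle^2}{\|a_i\|_2^2\|a_j\|_2^2}$, set $N_{ii}=\sum_{j=1}^m g_{i,j}\|a_j\|_2^2$ and $N_{ij}=-g_{i,j}\langle a_i,a_j\rangle$ for $i\ne j$. $N$ is symmetric positive definite and $N^{1/2}$ is its symmetric positive definite square root. *)

(* Defs.v *)
From mathcomp Require Import all_boot all_order all_algebra.
From mathcomp Require Import boolp classical_sets reals trigo.

Set Implicit Arguments.
Unset Strict Implicit.
Unset Printing Implicit Defensive.

Import Order.TTheory GRing.Theory Num.Theory.

Local Open Scope classical_set_scope.
Local Open Scope ring_scope.

Section LinearAlgebra.
Context {R : realType}.

Definition dot n (u v : 'cV[R]_n) : R := \sum_i u i 0 * v i 0.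

(* The canonical norm `|u| of a real matrix is the sup norm, hence norm2. *)
Definition norm2 n (u : 'cV[R]_n) : R := Num.sqrt (dot u u).

Definition frob m n (A : 'M[R]_(m, n)) : R :=
  Num.sqrt (\sum_i \sum_j A i j ^+ 2).

Definition is_mp_pinv m n (A : 'M[R]_(m, n)) (X : 'M[R]_(n, m)) : Prop :=
  [/\ A *m X *m A = A, X *m A *m X = X,
      (A *m X)^T = A *m X & (X *m A)^T = X *m A].

(* mathcomp's pinvmx is only a one-sided inverse on the row space; the
   Moore-Penrose inverse is the unique solution of the Penrose equations. *)
Definition mp_pinv m n (A : 'M[R]_(m, n)) : 'M[R]_(n, m) :=
  xget 0 [set X | is_mp_pinv A X].

Definition is_spd_sqrt m (S H : 'M[R]_m) : Prop :=
  [/\ H^T = H, (forall y : 'cV[R]_m, y != 0 -> 0 < dot y (H *m y))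
    & H *m H = S].

(* Meaningful when S is symmetric positive definite: such an H then exists
   and is unique. *)
Definition spd_sqrt m (S : 'M[R]_m) : 'M[R]_m :=
  xget 0 [set H | is_spd_sqrt S H].

(* The nonzero singular values of B are the positive square roots of the
   eigenvalues of B^T B; there are finitely many, and at least one as soon as
   B != 0, so that the infimum is then the smallest one. *)
Definition sigma_min m n (B : 'M[R]_(m, n)) : R :=
  inf [set s : R | 0 < s /\ eigenvalue (B^T *m B) (s ^+ 2)].

Definition angle n (u v : 'cV[R]_n) : R :=
  acos (dot u v / (norm2 u * norm2 v)).

End LinearAlgebra.

Section Method.
Context {R : realType} {m n : nat}.
Variables (A : 'M[R]_(m, n)) (b : 'cV[R]_m).

Implicit Types (x xp : 'cV[R]_n) (p : 'I_m * 'I_m).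

(* a_i, as a column vector; the i-th row of A is its transpose. *)
Definition arow (i : 'I_m) : 'cV[R]_n := (row i A)^T.

Definition refl (i : 'I_m) x : 'cV[R]_n :=
  x - (2 * ((dot (arow i) x - b i 0) / norm2 (arow i) ^+ 2)) *: arow i.

(* A pair p = (i_1, i_2) is reflected through i_1 first. *)
Definition refl2 p x : 'cV[R]_n := refl p.2 (refl p.1 x).

Definition acceptable x p : bool := refl2 p x != x.

(** Sampling strategies, as laws on ordered pairs of indices *)

Definition strategyI p : R :=
  if p.1 == p.2 then 0
  else norm2 (arow p.1) ^+ 2 / frob A ^+ 2 *
       (norm2 (arow p.2) ^+ 2 / (frob A ^+ 2 - norm2 (arow p.1) ^+ 2)).

Definition rows_in (S : {set 'I_m}) : 'M[R]_(#|S|, n) :=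
  rowsub (@enum_val _ (mem S)) A.

Definition gram_det (S : {set 'I_m}) : R :=
  \det (rows_in S *m (rows_in S)^T).

Definition volume_prob (S : {set 'I_m}) : R :=
  gram_det S / \sum_(J : {set 'I_m} | #|J| == 2%N) gram_det J.

(* Volume sampling only prescribes the law of the unordered pair {i_1, i_2}:
   any law on ordered pairs inducing it is a possible labelling rule. *)
Definition strategyII (q : 'I_m * 'I_m -> R) : Prop :=
  [/\ (forall p, 0 <= q p), \sum_p q p = 1 &
      forall S : {set 'I_m}, #|S| = 2%N ->
        \sum_(p | [set p.1; p.2]%SET == S) q p = volume_prob S].

(** One iteration from the consecutive iterates xp, x with the pair p *)

Definition coef_u x p : R :=
  (dot (arow p.1) x - b p.1 0) / norm2 (arow p.1) ^+ 2.

Definition coef_v x p : R :=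
  (dot (arow p.2) x - b p.2 0
     - 2 * dot (arow p.2) (arow p.1) * coef_u x p) / norm2 (arow p.2) ^+ 2.

Definition dir_w x p : 'cV[R]_n :=
  coef_u x p *: arow p.1 + coef_v x p *: arow p.2.

Definition gap x p : R :=
  dot (dir_w x p) x - (coef_u x p * b p.1 0 + coef_v x p * b p.2 0).

Definition denom xp x p : R :=
  norm2 (x - xp) ^+ 2 * norm2 (dir_w x p) ^+ 2
    - dot (dir_w x p) (x - xp) ^+ 2.

Definition alpha xp x p : R :=
  norm2 (x - xp) ^+ 2 * gap x p / (2 * denom xp x p).

Definition beta xp x p : R :=
  dot (dir_w x p) (x - xp) * gap x p / denom xp x p.

Definition half_step x p : 'cV[R]_n := 2^-1 *: x + 2^-1 *: refl2 p x.

Definition next_iterate xp x p : 'cV[R]_n :=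
  (1 - alpha xp x p) *: x + alpha xp x p *: refl2 p x
    + beta xp x p *: (x - xp).

(* x 0, ..., x K is a possible realization of the first K iterations started
   at x0, the draws of iteration k having law [law k]: the pair accepted at
   each iteration has positive probability and moves the current iterate. *)
Definition AmPRDR_run (law : nat -> 'I_m * 'I_m -> R) (x0 : 'cV[R]_n)
    (K : nat) (x : nat -> 'cV[R]_n) : Prop :=
  [/\ x 0%N = x0,
      (0 < K)%N ->
        exists p, [/\ 0 < law 0%N p, acceptable (x 0%N) p
                    & x 1%N = half_step (x 0%N) p] &
      forall k, (1 <= k < K)%N ->
        exists p, [/\ 0 < law k p, acceptable (x k) p
                    & x k.+1 = next_iterate (x k.-1) (x k) p]].

(* Expectation of f at the accepted pair when the current iterate is x: the
   pair has law q conditioned on being acceptable. *)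
Definition accepted_expectation (q : 'I_m * 'I_m -> R) x
    (f : 'I_m * 'I_m -> R) : R :=
  (\sum_(p | acceptable x p) q p * f p) / \sum_(p | acceptable x p) q p.

Definition xstar (x0 : 'cV[R]_n) : 'cV[R]_n :=
  mp_pinv A *m b + (1%:M - mp_pinv A *m A) *m x0.

Definition zeta xp x p : 'cV[R]_n :=
  let d := refl2 p x - x in
  dot d (x - xp) *: d - norm2 d ^+ 2 *: (x - xp).

Definition cos_theta (xs : 'cV[R]_n) xp x p : R :=
  if half_step x p == xs then 0
  else cos (angle (half_step x p - xs) (zeta xp x p)).

Definition gamma (xs : 'cV[R]_n) xp x : R :=
  inf [set cos_theta xs xp x p ^+ 2 | p in [set p | acceptable x p]].

End Method.

Section WeightMatrices.
Context {R : realType} {m n : nat}.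
Variable A : 'M[R]_(m, n).

Let a : 'I_m -> 'cV[R]_n := arow A.

Definition Delta : R :=
  \sum_j norm2 (a j) ^+ 2 / (frob A ^+ 2 - norm2 (a j) ^+ 2).

Definition matM : 'M[R]_m :=
  \matrix_(i, j)
    if i == j then
      Delta + 1 - norm2 (a i) ^+ 2 / (frob A ^+ 2 - norm2 (a i) ^+ 2)
    else - (2 * dot (a i) (a j) / (frob A ^+ 2 - norm2 (a j) ^+ 2)).

Definition sqrtM : 'M[R]_m := spd_sqrt (2^-1 *: (matM + matM^T)).

Definition gcoef (i j : 'I_m) : R :=
  1 - dot (a i) (a j) ^+ 2 / (norm2 (a i) ^+ 2 * norm2 (a j) ^+ 2).

Definition matN : 'M[R]_m :=
  \matrix_(i, j)
    if i == j then \sum_l gcoef i l * norm2 (a l) ^+ 2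
    else - (gcoef i j * dot (a i) (a j)).

Definition sqrtN : 'M[R]_m := spd_sqrt matN.

End WeightMatrices.

(* Main.v *)
From mathcomp Require Import all_boot all_order all_algebra.
From mathcomp Require Import boolp classical_sets reals trigo spectral complex ring.
Require Import Defs.

(** The idea is that one accelerated step is an orthogonal projection, and that
    on average it does at least as much as the plain half step.

    Write e = x - xs for the error, d = x - xp for the last displacement and w
    for the direction [dir_w], so that the reflected point is x - 2 w and the
    half step is x - w. Reflections through hyperplanes containing xs do not
    change the distance to xs, hence <w, e> = |w|^2 ([dir_w_error]), and the
    half step has squared error |e|^2 - |w|^2. The coefficients alpha and beta
    are those for which the new error is the component of e orthogonal to w and
    d, given that <e, d> = 0; this orthogonality is reproduced at the next step
    ([next_iterate_regular]), so it holds along the run ([run_regular]). It also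
    makes w and d linearly independent, so that no denominator vanishes. In the
    plane spanned by w and d the vector zeta is the direction orthogonal to w,
    so passing from the half step to the projection multiplies the squared error
    by 1 - cos^2 theta ([projection_cos]). This yields the factor 1 - gamma and
    leaves E|w|^2 >= kappa |e|^2 to be shown for each strategy, where
    conditioning on acceptance only helps because rejected pairs have w = 0
    ([expectation_le]).

    Put r = A e. For a pair (i, j) one finds
    |w|^2 = |r_i a_j - r_j a_i|^2 / (|a_i|^2 |a_j|^2), so under either strategy
    E|w|^2 is bounded below by a multiple of a sum
    sum_(i, j) c_ij |r_i a_j - r_j a_i|^2 with nonnegative weights c, positive
    when rows i and j are independent. Such a sum
    is the quadratic form of an explicit symmetric matrix ([pair_mx],
    [dot_pair_mx]): the symmetric part of M for c_ij = 1 / (|A|_F^2 - |a_i|^2)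
    ([sqrtME]) and N for half of the coefficients g_ij ([sqrtNE]). As A has rank
    at least two, every row is independent from some other row, which makes the
    form positive definite ([pair_mx_posdef]).

    Finally, if S is symmetric positive definite and e lies in the row space of
    A, then <A e, S A e> = |S^(1/2) A e|^2 >= sigma_min (S^(1/2) A)^2 |e|^2
    ([sigma_min_sqrt_le]). The square root and this bound both come from the
    spectral theorem for real symmetric matrices ([sym_spectral]). The error is
    in the row space because xs differs from the starting point by a vector of
    the row space ([xstar_row]), and so does every iterate ([run_rowspace]). *)

Set Implicit Arguments.
Unset Strict Implicit.
Unset Printing Implicit Defensive.

Import Order.TTheory GRing.Theory Num.Theory.

Local Open Scope classical_set_scope.
Local Open Scope ring_scope.

(** * The Euclidean inner product *)

Section Dot.
Context {R : realType}.

Lemma mul_tr_dot n (u v : 'cV[R]_n) : (u^T *m v) = (dot u v)%:M.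
Proof.
apply/matrixP=> i j; rewrite !ord1 !mxE eqxx mulr1n.
by apply: eq_bigr => k _; rewrite !mxE.
Qed.

Lemma dotC n (u v : 'cV[R]_n) : dot u v = dot v u.
Proof. by apply: eq_bigr => i _; rewrite mulrC. Qed.

Lemma dotDl n (u v w : 'cV[R]_n) : dot (u + v) w = dot u w + dot v w.
Proof. by rewrite -big_split; apply: eq_bigr => i _; rewrite !mxE mulrDl. Qed.

Lemma dotZl n a (u w : 'cV[R]_n) : dot (a *: u) w = a * dot u w.
Proof. by rewrite mulr_sumr; apply: eq_bigr => i _; rewrite !mxE mulrA. Qed.

Lemma dotNl n (u w : 'cV[R]_n) : dot (- u) w = - dot u w.
Proof. by rewrite -scaleN1r dotZl mulN1r. Qed.

Lemma dotDr n (u v w : 'cV[R]_n) : dot w (u + v) = dot w u + dot w v.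
Proof. by rewrite dotC dotDl !(dotC w). Qed.

Lemma dotZr n a (u w : 'cV[R]_n) : dot w (a *: u) = a * dot w u.
Proof. by rewrite dotC dotZl (dotC w). Qed.

Lemma dotNr n (u w : 'cV[R]_n) : dot w (- u) = - dot w u.
Proof. by rewrite dotC dotNl (dotC w). Qed.

Definition dot_lin := (dotDl, dotDr, dotNl, dotNr, dotZl, dotZr).

Lemma dot0l n (u : 'cV[R]_n) : dot 0 u = 0.
Proof. by rewrite -(scale0r 0) dotZl mul0r. Qed.

Lemma dot0r n (u : 'cV[R]_n) : dot u 0 = 0.
Proof. by rewrite dotC dot0l. Qed.

Lemma dot_ge0 n (u : 'cV[R]_n) : 0 <= dot u u.
Proof. by apply: sumr_ge0 => i _; rewrite -expr2 sqr_ge0. Qed.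

Lemma dot_eq0 n (u : 'cV[R]_n) : (dot u u == 0) = (u == 0).
Proof.
apply/eqP/eqP=> [uu0|->]; last by rewrite dot0l.
have /psumr_eq0P uP : forall i : 'I_n, true -> 0 <= u i 0 * u i 0.
  by move=> i _; rewrite -expr2 sqr_ge0.
apply/colP=> i; rewrite mxE; apply/eqP.
by rewrite -sqrf_eq0 expr2 uP.
Qed.

Lemma dot_gt0 n (u : 'cV[R]_n) : (0 < dot u u) = (u != 0).
Proof. by rewrite lt_def dot_ge0 andbT dot_eq0. Qed.

Lemma norm2_sq n (u : 'cV[R]_n) : norm2 u ^+ 2 = dot u u.
Proof. by rewrite sqr_sqrtr ?dot_ge0. Qed.

Lemma dot_mulmx m n (A : 'M[R]_(m, n)) u v :
  dot (A *m u) v = dot u (A^T *m v).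
Proof.
have inj : injective (@scalar_mx R 1) by apply: fmorph_inj.
by apply: inj; rewrite -!mul_tr_dot trmx_mul mulmxA.
Qed.

(** The identity behind it, <v,v> (<u,u><v,v> - <u,v>^2) = |<v,v> u - <u,v> v|^2,
    also gives the case of equality. *)
Lemma cauchy_schwarz n (u v : 'cV[R]_n) :
  dot u v ^+ 2 <= dot u u * dot v v ?= iff (dot v v *: u == dot u v *: v).
Proof.
have [->|v0] := eqVneq v 0.
  apply/leifP.
  by rewrite !dot0r mulr0 expr0n scale0r scaler0 /= eqxx.
have vv : 0 < dot v v by rewrite dot_gt0.
have E : dot (dot v v *: u - dot u v *: v) (dot v v *: u - dot u v *: v)
   = dot v v * (dot u u * dot v v - dot u v ^+ 2).
  by rewrite !dot_lin (dotC v u); ring.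
split.
  by rewrite -subr_ge0 -(pmulr_rge0 _ vv) -E dot_ge0.
rewrite -[RHS]subr_eq0 -dot_eq0 E mulf_eq0 (gt_eqF vv) /= subr_eq0.
by rewrite eq_sym.
Qed.

End Dot.

(** * The spectral theorem for real symmetric matrices *)

Section Spectral.
Context {R : realType}.

(** Over the complex numbers the matrix is Hermitian, so it is unitarily similar
    to a diagonal matrix with real entries; having an eigenvalue in a subfield
    does not depend on the field. *)
Lemma sym_eigenvalue n (S : 'M[R]_n.+1) : S^T = S ->
  exists l, eigenvalue S l.
Proof.
move=> Ssym; pose f := real_complex R; pose SC := map_mx f S.
have SCherm : SC \is hermsymmx.
  apply: realsym_hermsym.
    by apply/is_hermitianmxP; rewrite expr0 scale1r map_mx_id // map_trmx Ssym.
  by apply/mxOverP => i j; rewrite mxE complex_real.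
have /orthomx_spectralP SCE := hermitian_normalmx SCherm.
have /mxOverP/(_ 0 0) dR := hermitian_spectral_diag_real SCherm.
set P := spectralmx SC in SCE; set d := spectral_diag SC in SCE dR.
have Pu : P \in unitmx := spectral_unit SC.
set l := complex.Re (d 0 0).
exists l; have <- : eigenvalue SC (f l) = eigenvalue S l by exact: eigenvalue_map.
have -> : f l = d 0 0 by rewrite /f RRe_real.
apply/eigenvalueP; exists (row 0 P); last first.
  apply: contraTneq Pu => P0.
  rewrite unitmxE (expand_det_row _ 0) big1 ?unitr0 // => j _.
  by move/rowP/(_ j): P0; rewrite !mxE => ->; rewrite mul0r.
rewrite SCE !mulmxA -row_mul mulmxV // row1.
by rewrite -rowE row_diag_mx -scalemxAl -rowE.
Qed.

Definition householder n (u : 'cV[R]_n) : 'M[R]_n :=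
  1%:M - (2 / dot u u) *: (u *m u^T).

Lemma householder_sym n (u : 'cV[R]_n) : (householder u)^T = householder u.
Proof. by rewrite /householder linearB linearZ /= trmx_mul trmxK trmx1. Qed.

Lemma householder_mul n (u x : 'cV[R]_n) :
  householder u *m x = x - (2 * dot u x / dot u u) *: u.
Proof.
rewrite mulmxBl mul1mx -scalemxAl -mulmxA mul_tr_dot mul_mx_scalar scalerA.
by rewrite mulrAC.
Qed.

Lemma householderK n (u : 'cV[R]_n) : householder u *m householder u = 1%:M.
Proof.
rewrite {1}/householder mulmxBl mul1mx -scalemxAl -mulmxA.
have -> : u^T *m householder u = - u^T.
  have [->|u0] := eqVneq u 0; first by rewrite linear0 mul0mx oppr0.
  apply: trmx_inj; rewrite trmx_mul householder_sym trmxK householder_mul.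
  rewrite linearN /= trmxK mulfK ?dot_eq0 //.
  by rewrite scaler_nat mulr2n opprD addNKr.
by rewrite mulmxN scalerN opprK /householder subrK.
Qed.

(** The reflection through the bisector of two vectors of equal length exchanges
    them. When u = v the vector u - v is zero, the division by zero returns zero
    and the matrix is the identity, which is still correct. *)
Lemma householder_swap n (u v : 'cV[R]_n) : dot u u = dot v v ->
  householder (u - v) *m u = v.
Proof.
move=> uv; rewrite householder_mul.
have [/eqP|uv0] := eqVneq (u - v) 0.
  by rewrite subr_eq0 => /eqP ->; rewrite subrr scaler0 subr0.
have -> : 2 * dot (u - v) u / dot (u - v) (u - v) = 1.
  have E : dot (u - v) (u - v) = 2 * dot (u - v) u.
    by rewrite !dot_lin (dotC v u) uv; ring.
  by rewrite -E divff // dot_eq0.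
by rewrite scale1r opprB addrC subrK.
Qed.

(** By induction on the size: a Householder reflection Q moves a unit eigenvector
    to the first basis vector e, so that Q S Q is block diagonal with a block of
    size one. *)
Lemma sym_spectral n (S : 'M[R]_n) : S^T = S ->
  exists (P : 'M[R]_n) (d : 'rV[R]_n),
    P *m P^T = 1%:M /\ S = P^T *m diag_mx d *m P.
Proof.
elim: n S => [|n IHn] S Ssym.
  by exists 1%:M, 0; split; apply/matrixP => -[].
have [l /eigenvalueP[v0 vS v0_neq0]] := sym_eigenvalue Ssym.
pose v := (norm2 v0^T)^-1 *: v0^T.
have Sv : S *m v = l *: v.
  by rewrite /v -scalemxAr -{1}Ssym -trmx_mul vS linearZ /= !scalerA mulrC.
have vv : dot v v = 1.
  have vv0 : dot v0^T v0^T != 0 by rewrite dot_eq0 trmx_eq0.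
  by rewrite /v !dot_lin mulrA -expr2 exprVn norm2_sq mulVf.
pose e : 'cV[R]_(1 + n) := delta_mx 0 0.
have ee : dot e e = dot v v.
  rewrite vv /dot (bigD1 0) //= big1 ?addr0 ?mxE ?mulr1 // => i /negPf i0.
  by rewrite mxE i0 mul0r.
pose Q : 'M[R]_(1 + n) := householder (e - v).
have Qe : Q *m e = v by exact: householder_swap.
have Qv : Q *m v = e by rewrite -Qe mulmxA householderK mul1mx.
pose T : 'M[R]_(1 + n) := Q *m S *m Q.
have Tsym : T^T = T by rewrite /T !trmx_mul householder_sym Ssym mulmxA.
have Te : T *m e = l *: e by rewrite -!mulmxA Qe Sv -scalemxAr Qv.
have ST : S = Q *m T *m Q.
  by rewrite /T !mulmxA householderK mul1mx -!mulmxA householderK mulmx1.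
have T0 i : T i (lshift n 0) = l *+ (i == lshift n 0).
  have -> : lshift n (0 : 'I_1) = 0 by apply: val_inj.
  have /colP/(_ i) := Te.
  by rewrite -colE !mxE andbT mulr_natr.
have TE : T = block_mx l%:M 0 0 (drsubmx T).
  rewrite -[LHS]submxK; congr block_mx.
  - apply/matrixP=> i j; rewrite (ord1 i) (ord1 j) [LHS]mxE mxE T0 !mxE !eqxx //.
  - apply/matrixP=> i j; rewrite (ord1 i) [LHS]mxE mxE -Tsym mxE T0 !mxE.
    by rewrite eq_rlshift.
  - by apply/matrixP=> i j; rewrite (ord1 j) [LHS]mxE mxE T0 !mxE eq_rlshift.
have T'sym : (drsubmx T)^T = drsubmx T by rewrite trmx_drsub Tsym.
have [P' [d' [P'P T'E]]] := IHn _ T'sym.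
pose B : 'M[R]_(1 + n) := block_mx 1%:M 0 0 P'.
have BT : B^T = block_mx 1%:M 0 0 P'^T.
  by rewrite /B tr_block_mx !trmx0 trmx1.
have BB : B *m B^T = 1%:M.
  rewrite BT /B mulmx_block P'P !mulmx0 !mul0mx mulmx1.
  by rewrite !addr0 add0r -scalar_mx_block.
have BTB : B^T *m diag_mx (row_mx (l%:M : 'M_1) d') *m B = T.
  rewrite TE T'E BT /B diag_mx_row !mulmx_block.
  rewrite !mulmx0 !mul0mx !mulmx1 !mul1mx !addr0 !add0r.
  congr block_mx; last by rewrite mul0mx.
  by apply/matrixP=> i j; rewrite !ord1 !mxE eqxx.
exists (B *m Q); exists (row_mx (l%:M : 'M_1) d'); split.
  rewrite trmx_mul householder_sym !mulmxA -(mulmxA B) householderK mulmx1.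
  exact: BB.
by rewrite trmx_mul householder_sym ST -BTB !mulmxA.
Qed.

End Spectral.

(** * Positive definite matrices, singular values and the pseudoinverse *)

Section PositiveDefinite.
Context {R : realType}.

Definition posdef n (S : 'M[R]_n) : Prop :=
  forall y : 'cV[R]_n, y != 0 -> 0 < dot y (S *m y).

Lemma dot_diag n (P : 'M[R]_n) (d : 'rV[R]_n) (y : 'cV[R]_n) :
  dot y (P^T *m diag_mx d *m P *m y) = \sum_i d 0 i * (P *m y) i 0 ^+ 2.
Proof.
rewrite -!mulmxA -dot_mulmx.
apply: eq_bigr => i _; by rewrite mul_diag_mx [X in _ * X]mxE expr2 mulrCA.
Qed.

Lemma posdef_diag n (P : 'M[R]_n) (d : 'rV[R]_n) :
  P *m P^T = 1%:M ->
  posdef (P^T *m diag_mx d *m P) <-> (forall i, 0 < d 0 i).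
Proof.
move=> PP; split=> [pd i | d0 y y0].
  pose y : 'cV[R]_n := P^T *m delta_mx i 0.
  have Py : P *m y = delta_mx i 0 by rewrite mulmxA PP mul1mx.
  have := pd y; rewrite dot_diag Py (bigD1 i) //= big1 ?addr0 => [|j ji].
    rewrite mxE !eqxx expr1n mulr1; apply; apply/eqP => y0.
    have /colP/(_ i)/eqP := Py.
    by rewrite y0 mulmx0 !mxE !eqxx eq_sym oner_eq0.
  by rewrite mxE (negPf ji) expr0n mulr0.
have /cV0Pn[i Pyi] : P *m y != 0.
  apply: contraNneq y0 => Py; rewrite -(mul1mx y).
  by rewrite -(mulmx1C PP) -mulmxA Py mulmx0.
rewrite dot_diag (bigD1 i) //= ltr_pwDl //.
  by rewrite mulr_gt0 // exprn_even_gt0.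
by apply: sumr_ge0 => j _; rewrite mulr_ge0 ?sqr_ge0 // ltW.
Qed.

(** The definition picks some solution, so only existence is needed: take square
    roots of the eigenvalues. *)
Lemma spd_sqrtP n (S : 'M[R]_n) : S^T = S -> posdef S ->
  is_spd_sqrt S (spd_sqrt S).
Proof.
move=> Ssym Spd; apply: (xgetPex 0).
have [P [d [PP SE]]] := sym_spectral Ssym.
have d_gt0 : forall i, 0 < d 0 i by apply/(posdef_diag _ PP); rewrite -SE.
pose r : 'rV[R]_n := \row_i Num.sqrt (d 0 i).
exists (P^T *m diag_mx r *m P); split.
- by rewrite !trmx_mul tr_diag_mx trmxK mulmxA.
- by apply/(posdef_diag _ PP) => i; rewrite mxE sqrtr_gt0.
- rewrite !mulmxA -(mulmxA _ P) PP mulmx1 SE; congr (_ *m _).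
  rewrite -mulmxA; congr (_ *m _).
  rewrite mulmx_diag; congr diag_mx; apply/rowP => i.
  by rewrite !mxE -expr2 sqr_sqrtr // ltW.
Qed.

(** Diagonalize B^T B. A coordinate of e along an eigenvector p with eigenvalue
    zero vanishes, since B p = 0 and e is a combination of the rows of B; the
    other eigenvalues are squares of nonzero singular values, hence at least
    sigma_min^2. *)
Lemma sigma_min_le m n (B : 'M[R]_(m, n)) (e : 'cV[R]_n) (f : 'cV[R]_m) :
  e = B^T *m f ->
  sigma_min B ^+ 2 * dot e e <= dot (B *m e) (B *m e).
Proof.
move=> eE.
have Gsym : (B^T *m B)^T = B^T *m B by rewrite trmx_mul trmxK.
have [P [d [PP GE]]] := sym_spectral Gsym.
have PP' := mulmx1C PP.
pose p i : 'cV[R]_n := (row i P)^T.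
have Gp i : B^T *m B *m p i = d 0 i *: p i.
  apply: trmx_inj; rewrite trmx_mul Gsym trmxK linearZ /= trmxK GE.
  by rewrite -!row_mul !mulmxA PP mul1mx row_mul row_diag_mx -scalemxAl -rowE.
have pp i : dot (p i) (p i) = 1.
  have /matrixP/(_ i i) := PP; rewrite !mxE eqxx mulr1n => <-.
  by apply: eq_bigr => k _; rewrite !mxE.
have dE i : d 0 i = dot (B *m p i) (B *m p i).
  by rewrite dot_mulmx mulmxA Gp dotZr pp mulr1.
have Pe i : (P *m e) i 0 = dot (p i) e.
  by rewrite mxE; apply: eq_bigr => k _; rewrite !mxE.
rewrite dot_mulmx [B^T *m _]mulmxA GE dot_diag.
have -> : dot e e = \sum_i (P *m e) i 0 ^+ 2.
  rewrite -{2}(mul1mx e) -PP' -mulmxA -dot_mulmx.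
  by apply: eq_bigr => i _; rewrite expr2.
rewrite mulr_sumr; apply: ler_sum => i _.
have [di0|di0] := eqVneq (d 0 i) 0.
  have Bp0 : B *m p i = 0 by apply/eqP; rewrite -dot_eq0 -dE di0.
  by rewrite Pe eE -dot_mulmx Bp0 dot0l expr0n !mulr0.
have di_gt0 : 0 < d 0 i by rewrite lt_def di0 dE dot_ge0.
apply: ler_wpM2r; first exact: sqr_ge0.
set s := Num.sqrt (d 0 i).
have s_gt0 : 0 < s by rewrite sqrtr_gt0.
have s2 : s ^+ 2 = d 0 i by rewrite sqr_sqrtr // ltW.
pose E := [set s : R | 0 < s /\ eigenvalue (B^T *m B) (s ^+ 2)].
have Es : E s.
  split=> //; apply/eigenvalueP; exists (p i)^T.
    by apply: trmx_inj; rewrite s2 trmx_mul Gsym trmxK Gp linearZ /= trmxK.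
  by rewrite trmx_eq0 -dot_eq0 pp oner_eq0.
have E0 : lbound E 0 by move=> t [/ltW].
rewrite -s2 ler_sqr ?nnegrE ?(ltW s_gt0) //.
  by apply: ge_inf => //; exists 0.
by apply: lb_le_inf => //; exists s.
Qed.

(** The square root H is invertible, so H A and A have the same row space. *)
Lemma sigma_min_sqrt_le m n (S : 'M[R]_m) (A : 'M[R]_(m, n)) (e : 'cV[R]_n)
    (f : 'cV[R]_m) :
  S^T = S -> posdef S -> e = A^T *m f ->
  sigma_min (spd_sqrt S *m A) ^+ 2 * dot e e <= dot (A *m e) (S *m (A *m e)).
Proof.
move=> Ssym Spd eE; have [] := spd_sqrtP Ssym Spd.
set H := spd_sqrt S => Hsym Hpd HH.
have Hu : H \in unitmx.
  rewrite -row_free_unit; apply: inj_row_free => v vH.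
  apply: trmx_inj; apply/eqP; rewrite linear0.
  apply: contraT => /Hpd; rewrite -{1}Hsym -trmx_mul vH.
  by rewrite linear0 dot0r ltxx.
have eHE : e = (H *m A)^T *m (invmx H *m f).
  by rewrite trmx_mul Hsym -mulmxA mulKVmx.
rewrite -HH -mulmxA -{2}Hsym -dot_mulmx mulmxA.
exact: sigma_min_le eHE.
Qed.

(** If v F F^T = 0 then |v F|^2 = 0, as the field is real. *)
Lemma row_free_gram r n (F : 'M[R]_(r, n)) : row_free F -> F *m F^T \in unitmx.
Proof.
move=> Ffree; rewrite -row_free_unit; apply: inj_row_free => v vFF.
apply: (row_free_inj Ffree); rewrite mul0mx; apply: trmx_inj.
apply/eqP; rewrite linear0 -dot_eq0; apply/eqP.
have := mul_tr_dot (v *m F)^T (v *m F)^T.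
rewrite trmxK trmx_mul -mulmxA (mulmxA F) (mulmxA v) vFF mul0mx.
by move/matrixP/(_ 0 0); rewrite !mxE eqxx.
Qed.

(** The pseudoinverse is explicit once the matrix is factored into a full column
    rank matrix and a full row rank matrix, because both Gram matrices are then
    invertible. *)
Lemma full_rank_mp_pinv m r n (C : 'M[R]_(m, r)) (F : 'M[R]_(r, n)) :
  row_full C -> row_free F ->
  is_mp_pinv (C *m F) (F^T *m invmx (F *m F^T) *m invmx (C^T *m C) *m C^T).
Proof.
move=> Cfull Ffree.
have Fu : F *m F^T \in unitmx by rewrite row_free_gram.
have Cu : C^T *m C \in unitmx.
  by rewrite -{2}(trmxK C) row_free_gram // /row_free mxrank_tr.
set X := (X in is_mp_pinv _ X).
have AX : C *m F *m X = C *m invmx (C^T *m C) *m C^T.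
  by rewrite /X !mulmxA -(mulmxA C) mulmxK.
have XA : X *m (C *m F) = F^T *m invmx (F *m F^T) *m F.
  by rewrite /X !mulmxA -(mulmxA _ C^T C) mulmxKV.
split.
- by rewrite AX !mulmxA -(mulmxA _ C^T C) mulmxKV.
- by rewrite XA /X !mulmxA -(mulmxA _ F F^T) mulmxKV.
- by rewrite AX !trmx_mul trmxK trmx_inv trmx_mul trmxK mulmxA.
- by rewrite XA !trmx_mul trmxK trmx_inv trmx_mul trmxK mulmxA.
Qed.

Lemma mp_pinvP m n (A : 'M[R]_(m, n)) : is_mp_pinv A (mp_pinv A).
Proof.
apply: (xgetPex 0); have := full_rank_mp_pinv (col_base_full A) (row_base_free A).
by rewrite mulmx_base => AX; eexists; exact: AX.
Qed.

End PositiveDefinite.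

(** * Projecting onto the plane spanned by the direction and the displacement *)

Section Projection.
Context {R : realType} {n : nat}.
Implicit Types e d w : 'cV[R]_n.

(** If u or v is zero, both sides are zero: the argument of acos is then 0. *)
Lemma cos_angle_sq (u v : 'cV[R]_n) :
  cos (angle u v) ^+ 2 = dot u v ^+ 2 / (dot u u * dot v v).
Proof.
have tE : (dot u v / (norm2 u * norm2 v)) ^+ 2
    = dot u v ^+ 2 / (dot u u * dot v v).
  by rewrite exprMn exprVn exprMn !norm2_sq.
rewrite /angle acosK // in_itv /= -ler_norml -ler_sqr ?nnegrE // expr1n.
rewrite real_normK ?num_real // tE.
have := mulr_ge0 (dot_ge0 u) (dot_ge0 v); rewrite le_eqVlt => /predU1P[<-|uv0].
  by rewrite invr0 mulr0 ler01.
by rewrite ler_pdivrMr // mul1r (cauchy_schwarz u v).1.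
Qed.

Variables e d w : 'cV[R]_n.
Hypotheses (d0 : d != 0) (w0 : w != 0).
Hypotheses (ed : dot e d = 0) (we : dot w e = dot w w).

Let D := dot d d * dot w w - dot w d ^+ 2.
(** With e the error, d the last displacement and w the reflection direction, e'
    is the error after the accelerated step: the component of e orthogonal to
    both w and d. *)
Let e' := e - (dot d d * dot w w / D) *: w + (dot w d * dot w w / D) *: d.

(** If w were proportional to d, it would be orthogonal to e, whereas
    <w, e> = |w|^2 is positive. *)
Lemma plane_gram_gt0 : 0 < D.
Proof.
have [le_dw eq_dw] := cauchy_schwarz w d.
rewrite subr_gt0 mulrC lt_neqAle le_dw andbT eq_dw.
apply: contraNN d0 => /eqP /(congr1 (fun v => dot v e)).
rewrite !dot_lin we (dotC d e) ed mulr0 => /eqP.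
by rewrite mulf_eq0 !dot_eq0 (negPf w0) orbF.
Qed.

Let Dn0 : D != 0 := lt0r_neq0 plane_gram_gt0.

Lemma projection_sq : dot e' e' = dot e e - dot d d * dot w w ^+ 2 / D.
Proof.
rewrite /e' !dot_lin (dotC d e) (dotC d w) (dotC e w) we ed.
move: Dn0; rewrite /D => ?; by field.
Qed.

(** The displacement e' - e is in the plane that e' is orthogonal to: this is the
    orthogonality <e, d> = 0 for the next step. *)
Lemma projection_orth : dot e' (e' - e) = 0.
Proof.
rewrite /e' !dot_lin (dotC d e) (dotC d w) (dotC e w) we ed.
move: Dn0; rewrite /D => ?; by field.
Qed.

(** As <e' - e, e> < 0, the new displacement is nonzero, which the next step needs
    of its own d. *)
Lemma projection_moves : e' != e.
Proof.
have : dot (e' - e) e < 0.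
  have -> : dot (e' - e) e = - (dot d d * dot w w ^+ 2 / D).
    by rewrite /e' !dot_lin (dotC d e) we ed; ring.
  by rewrite oppr_lt0 divr_gt0 ?plane_gram_gt0 // mulr_gt0 ?exprn_gt0 // dot_gt0.
by apply: contraTneq => ->; rewrite subrr dot0l ltxx.
Qed.

Lemma relaxation_sq : dot (e - w) (e - w) = dot e e - dot w w.
Proof. by rewrite !dot_lin (dotC e w) we; ring. Qed.

(** The plane of w and d is spanned by the orthogonal vectors w and z. Removing
    the w-component of e gives u = e - w, and removing its z-component then
    multiplies the squared length by 1 - cos^2 (u, z). *)
Lemma projection_cos (u := e - w) (z := dot w d *: w - dot w w *: d) :
  dot e' e' =
    (1 - (if u == 0 then 0 else dot u z ^+ 2 / (dot u u * dot z z)))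
    * (dot e e - dot w w).
Proof.
rewrite projection_sq.
have [/eqP|u0] := eqVneq u 0.
  rewrite subr_eq0 => /eqP ew; have wd : dot w d = 0 by rewrite -ew.
  rewrite ew /D wd; have := d0; have := w0; rewrite -!dot_eq0 => ? ?.
  by field; apply/andP.
have uu0 : dot e e - dot w w != 0 by rewrite -relaxation_sq dot_eq0.
have ww0 : dot w w != 0 by rewrite dot_eq0.
have -> : dot u z = dot w w * dot w d.
  by rewrite /u /z !dot_lin (dotC e w) we ed; ring.
have -> : dot z z = dot w w * D.
  by rewrite /z /D !dot_lin (dotC d w); ring.
rewrite relaxation_sq; move: Dn0; rewrite /D => ?; by field; apply/and3P; split.
Qed.

End Projection.

(** * One iteration *)

Section Iteration.
Context {R : realType} {m n : nat}.
Variables (A : 'M[R]_(m, n)) (b : 'cV[R]_m) (xs : 'cV[R]_n).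
Hypotheses (rows_neq0 : forall i, row i A != 0) (sol : A *m xs = b).
Implicit Types (x xp : 'cV[R]_n) (p : 'I_m * 'I_m).

Local Notation a := (arow A).

Lemma arow_gt0 i : 0 < dot (a i) (a i).
Proof. by rewrite dot_gt0 /arow trmx_eq0. Qed.

Lemma dot_arow i x : dot (a i) x = (A *m x) i 0.
Proof. by rewrite mxE; apply: eq_bigr => j _; rewrite !mxE. Qed.

Lemma residual i x : dot (a i) x - b i 0 = dot (a i) (x - xs).
Proof. by rewrite dotDr dotNr (dot_arow i xs) sol. Qed.

Lemma refl2E x p : refl2 A b p x = x - 2 *: dir_w A b x p.
Proof.
rewrite /refl2 /refl /dir_w -/(coef_u A b x p).
set u := coef_u A b x p; set v := coef_v A b x p.
have -> : (dot (a p.2) (x - (2 * u) *: a p.1) - b p.2 0) / norm2 (a p.2) ^+ 2 = v.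
  by rewrite /v /coef_v -/u !dot_lin; congr (_ / _); ring.
by rewrite scalerDr !scalerA opprD addrA.
Qed.

Lemma acceptableE x p : acceptable A b x p = (dir_w A b x p != 0).
Proof.
rewrite /acceptable refl2E -subr_eq0 addrAC subrr add0r oppr_eq0 scaler_eq0.
by rewrite pnatr_eq0.
Qed.

Lemma half_stepE x p : half_step A b x p = x - dir_w A b x p.
Proof.
rewrite /half_step refl2E; move: (dir_w _ _ _ _) => w.
by apply/colP => i; rewrite !mxE; field.
Qed.

Lemma zetaE xp x p (w := dir_w A b x p) :
  zeta A b xp x p = 4 *: (dot w (x - xp) *: w - dot w w *: (x - xp)).
Proof.
rewrite /zeta norm2_sq refl2E addrAC subrr add0r {}/w.
move: (dir_w A b x p) (x - xp) => w d; rewrite !dot_lin.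
by apply/colP => i; rewrite !mxE; ring.
Qed.

Lemma gapE x p : gap A b x p = dot (dir_w A b x p) (x - xs).
Proof.
rewrite /gap /dir_w !dot_lin (dot_arow p.1 xs) (dot_arow p.2 xs) sol.
by ring.
Qed.

Lemma dir_w_sq x p (r := fun i => dot (a i) (x - xs))
    (z := r p.1 *: a p.2 - r p.2 *: a p.1) :
  dot (dir_w A b x p) (dir_w A b x p)
    = dot z z / (dot (a p.1) (a p.1) * dot (a p.2) (a p.2)).
Proof.
rewrite /dir_w /coef_v /coef_u !norm2_sq !residual -/(r _) -/(r _).
have := lt0r_neq0 (arow_gt0 p.1); have := lt0r_neq0 (arow_gt0 p.2).
rewrite /z !dot_lin (dotC (a p.2) (a p.1)) => ? ?.
by field; apply/andP.
Qed.

(** Reflections are isometries fixing the solution: |e - 2 w|^2 = |e|^2. *)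
Lemma dir_w_error x p :
  dot (dir_w A b x p) (x - xs) = dot (dir_w A b x p) (dir_w A b x p).
Proof.
rewrite /dir_w /coef_v /coef_u !norm2_sq !residual.
have := lt0r_neq0 (arow_gt0 p.1); have := lt0r_neq0 (arow_gt0 p.2).
rewrite !(dotDl, dotDr, dotZl, dotZr) (dotC (a p.2) (a p.1)) => ? ?.
by field; apply/andP.
Qed.

Lemma next_iterateE xp x p (w := dir_w A b x p) (d := x - xp)
    (D := dot d d * dot w w - dot w d ^+ 2) : D != 0 ->
  next_iterate A b xp x p - xs =
    (x - xs) - (dot d d * dot w w / D) *: w + (dot w d * dot w w / D) *: d.
Proof.
move=> Dn0; rewrite /next_iterate refl2E -/w -/d.
have -> : alpha A b xp x p = 2^-1 * (dot d d * dot w w / D).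
  rewrite /alpha /denom gapE dir_w_error !norm2_sq -/w -/d -/D.
  by field.
have -> : beta A b xp x p = dot w d * dot w w / D.
  by rewrite /beta /denom gapE dir_w_error !norm2_sq.
set c := dot d d * _ / D; set c' := dot w d * _ / D.
apply/colP => i; rewrite !mxE; by field.
Qed.

Lemma cos_theta_sq xp x p (w := dir_w A b x p) (d := x - xp)
    (u := x - xs - w) (z := dot w d *: w - dot w w *: d) :
  cos_theta A b xs xp x p ^+ 2
    = if u == 0 then 0 else dot u z ^+ 2 / (dot u u * dot z z).
Proof.
rewrite /cos_theta half_stepE -/w -subr_eq0 addrAC -/u.
case: ifP => // _; first by rewrite expr0n.
rewrite cos_angle_sq zetaE -/w -/d -/z; move: (z) => v.
rewrite !(dotZl, dotZr) exprMn (mulrA 4 4) (mulrCA (dot u u)) -expr2 -mulf_div.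
by rewrite divff ?mul1r // expf_neq0 // pnatr_eq0.
Qed.

Lemma gamma_le xp x p : acceptable A b x p ->
  gamma A b xs xp x <= cos_theta A b xs xp x p ^+ 2.
Proof.
move=> xp_acc; apply: ge_inf; last by exists p.
by exists 0 => _ [q _ <-]; exact: sqr_ge0.
Qed.

(** This includes the case where no pair is acceptable, in which the infimum of
    the empty set is 0. *)
Lemma gamma_le1 xp x : gamma A b xs xp x <= 1.
Proof.
case: (pselect (exists p, acceptable A b x p)) => [[p xp_acc]|no_acc].
  apply: le_trans (gamma_le xp xp_acc) _; rewrite /cos_theta.
  case: ifP => _; first by rewrite expr0n.
  set t := angle _ _.
  by rewrite -[leRHS](cos2Dsin2 t) lerDl sqr_ge0.
rewrite /gamma (_ : [set p | _] = set0) ?image_set0 ?inf0 //.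
by apply/seteqP; split=> // p xp_acc; case: no_acc; exists p.
Qed.

(** The accelerated step beats the half step by the factor 1 - cos^2 theta, and
    gamma is the infimum of these cos^2. *)
Lemma next_iterate_le xp x p : acceptable A b x p -> x != xp ->
  dot (x - xs) (x - xp) = 0 ->
  norm2 (next_iterate A b xp x p - xs) ^+ 2 <=
  (1 - gamma A b xs xp x) *
  (norm2 (x - xs) ^+ 2 - norm2 (dir_w A b x p) ^+ 2).
Proof.
move=> xp_acc; rewrite -subr_eq0 !norm2_sq => d0 ed.
have w0 := xp_acc; rewrite acceptableE in w0.
have we := dir_w_error x p.
rewrite next_iterateE; last exact/lt0r_neq0/(plane_gram_gt0 d0 w0 ed we).
rewrite (projection_cos d0 w0 ed we) -cos_theta_sq.
rewrite ler_wpM2r //.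
  by rewrite -relaxation_sq // dot_ge0.
by rewrite lerD2l lerN2 gamma_le.
Qed.

(** Rejected pairs have w = 0 and do not contribute to the mean of |w|^2, so
    conditioning on acceptance divides that mean by a probability at most 1. If
    this probability is zero then kappa |e|^2 <= 0 and the right-hand side is
    nonnegative, in agreement with the convention on division by zero. *)
Lemma expectation_le (q : 'I_m * 'I_m -> R) xp x kappa :
    (forall p, 0 <= q p) -> \sum_p q p <= 1 ->
    x != xp -> dot (x - xs) (x - xp) = 0 ->
    kappa * norm2 (x - xs) ^+ 2 <= \sum_p q p * norm2 (dir_w A b x p) ^+ 2 ->
  accepted_expectation A b q x
    (fun p => norm2 (next_iterate A b xp x p - xs) ^+ 2)
  <= (1 - gamma A b xs xp x) * (1 - kappa) * norm2 (x - xs) ^+ 2.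
Proof.
move=> q0 q1 d0 ed; set E := norm2 (x - xs) ^+ 2; set W := \sum_p _ => kW.
rewrite /accepted_expectation; set Q := \sum_(p | _) q p.
have WE : W = \sum_(p | acceptable A b x p) q p * norm2 (dir_w A b x p) ^+ 2.
  rewrite /W (bigID (acceptable A b x)) /= [X in _ + X]big1 ?addr0 // => p.
  by rewrite acceptableE negbK => /eqP ->; rewrite norm2_sq dot0l mulr0.
have Q0 : 0 <= Q by rewrite sumr_ge0.
have Q1 : Q <= 1.
  apply: le_trans q1; rewrite [leRHS](bigID (acceptable A b x)) /= lerDl.
  by rewrite sumr_ge0.
have g0 : 0 <= 1 - gamma A b xs xp x by rewrite subr_ge0 gamma_le1.
have W0 : 0 <= W by rewrite sumr_ge0 // => p _; rewrite mulr_ge0 ?sqr_ge0.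
have WQ : W <= Q * E.
  rewrite WE /Q mulr_suml; apply: ler_sum => p _; rewrite ler_wpM2l //.
  by rewrite /E !norm2_sq -subr_ge0 -relaxation_sq ?dir_w_error // dot_ge0.
apply: (@le_trans _ _ ((1 - gamma A b xs xp x) * (Q * E - W) / Q)).
  rewrite ler_wpM2r ?invr_ge0 // WE /Q mulr_suml -sumrB mulr_sumr.
  apply: ler_sum => p p_acc; rewrite -mulrBr [leRHS]mulrCA ler_wpM2l //.
  exact: next_iterate_le.
rewrite -!mulrA ler_wpM2l // [leRHS]mulrBl mul1r.
apply: (@le_trans _ _ (E - W)); last by rewrite lerD2l lerN2.
move: Q0; rewrite le_eqVlt => /predU1P[Q0|Q_gt0].
  by rewrite -Q0 invr0 mulr0 subr_ge0 (le_trans WQ) // -Q0 mul0r sqr_ge0.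
rewrite ler_pdivrMr // mulrBl (mulrC E) lerD2l lerN2.
by rewrite ler_piMr.
Qed.

Lemma dir_w_rowspace x p : ((dir_w A b x p)^T <= A)%MS.
Proof.
by rewrite linearD !linearZ /= !trmxK addmx_sub // scalemx_sub // row_sub.
Qed.

(** What the analysis of a step requires of the preceding one: the orthogonality
    keeps the error perpendicular to the last displacement, and the row space
    condition keeps the error where the singular value bound applies. *)
Definition regular_step xp x : Prop :=
  [/\ ((x - xp)^T <= A)%MS, x != xp & dot (x - xs) (x - xp) = 0].

Lemma half_step_regular x p : acceptable A b x p ->
  regular_step x (half_step A b x p).
Proof.
rewrite acceptableE half_stepE /regular_step => w0.
set w := dir_w A b x p in w0 *.
rewrite -subr_eq0 addrAC subrr add0r; split.
- by rewrite linearN /= eqmx_opp dir_w_rowspace.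
- by rewrite oppr_eq0.
- by rewrite addrAC dotNr dotDl dotNl dotC dir_w_error subrr oppr0.
Qed.

Lemma next_iterate_regular xp x p : regular_step xp x -> acceptable A b x p ->
  regular_step x (next_iterate A b xp x p).
Proof.
move=> [d_row]; rewrite -subr_eq0 acceptableE => d0 ed w0.
have we := dir_w_error x p.
have nextE := next_iterateE (lt0r_neq0 (plane_gram_gt0 d0 w0 ed we)).
have moveE : next_iterate A b xp x p - x
    = (next_iterate A b xp x p - xs) - (x - xs) by rewrite opprB addrA subrK.
rewrite /regular_step -(subr_eq0 _ x) moveE nextE; split.
- rewrite addrC -addrA addKr linearD linearN !linearZ /=.
  by rewrite addmx_sub ?scalemx_sub ?eqmx_opp ?dir_w_rowspace.
- by rewrite subr_eq0; exact: projection_moves.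
- exact: projection_orth.
Qed.

Lemma run_regular law x0 K (x : nat -> 'cV[R]_n) :
    AmPRDR_run A b law x0 K x -> forall k, (k < K)%N ->
  regular_step (x k) (x k.+1).
Proof.
case=> _ x_1 x_S; elim=> [|k IHk] kK.
  by have [p [_ p_acc ->]] := x_1 kK; exact: half_step_regular.
have [//|p [_ p_acc ->]] := x_S k.+1.
exact: next_iterate_regular (IHk (ltnW kK)) p_acc.
Qed.

Lemma run_rowspace law x0 K (x : nat -> 'cV[R]_n) :
    AmPRDR_run A b law x0 K x -> forall k, (k <= K)%N ->
  ((x k - x0)^T <= A)%MS.
Proof.
move=> run; have [x_0 _ _] := run; elim=> [|k IHk] kK.
  by rewrite x_0 subrr linear0 sub0mx.
have [d_row _ _] := run_regular run kK.
by rewrite -(subrK (x k) (x k.+1)) -addrA linearD addmx_sub // IHk // ltnW.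
Qed.

End Iteration.

(** * Quadratic forms built from pairs of rows *)

Section Weights.
Context {R : realType} {m n : nat}.
Variable A : 'M[R]_(m, n).
Hypotheses (rows_neq0 : forall i, row i A != 0) (rank_ge2 : (2 <= \rank A)%N).

Local Notation a := (arow A).
Local Notation nrm i := (dot (a i) (a i)).
Implicit Types (c : 'I_m -> 'I_m -> R) (y : 'cV[R]_m).

(** For y = A e, the length of w is that of this vector divided by |a_i| |a_j|. *)
Definition cross (y : 'cV[R]_m) i j : 'cV[R]_n := y i 0 *: a j - y j 0 *: a i.

Lemma crossC y i j : cross y i j = - cross y j i.
Proof. by rewrite /cross opprB. Qed.

Lemma cross_diag y i : cross y i i = 0.
Proof. by rewrite /cross subrr. Qed.

(** The determinant of the Gram matrix of rows i and j. *)
Definition minor i j : R := nrm i * nrm j - dot (a i) (a j) ^+ 2.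

Lemma minorC i j : minor i j = minor j i.
Proof. by rewrite /minor mulrC (dotC (a i)). Qed.

Lemma minor_ge0 i j : 0 <= minor i j.
Proof. by rewrite subr_ge0 (cauchy_schwarz _ _).1. Qed.

Lemma minor_diag i : minor i i = 0.
Proof. by rewrite /minor -expr2 subrr. Qed.

Lemma minor_cross_gt0 y i j : y i 0 != 0 -> 0 < minor i j ->
  0 < dot (cross y i j) (cross y i j).
Proof.
move=> yi0; rewrite dot_gt0; apply: contraTneq => /eqP.
rewrite subr_eq0 => /eqP E; rewrite /minor.
have -> : a j = (y j 0 / y i 0) *: a i.
  by rewrite mulrC -scalerA -E scalerA mulVf // scale1r.
rewrite !dot_lin; set t := _ / _.
by rewrite (_ : _ - _ = 0) ?ltxx //; ring.
Qed.

(** Otherwise every row is a multiple of row i, and A has rank at most one. *)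
Lemma exists_independent i : exists j, 0 < minor i j.
Proof.
apply: contrapT => no_j.
have par j : a j = (dot (a j) (a i) / nrm i) *: a i.
  have nij : dot (a j) (a i) ^+ 2 == nrm j * nrm i.
    rewrite eq_le (cauchy_schwarz _ _).1 -subr_le0 /= leNgt.
    by apply/negP => lt; apply: no_j; exists j; rewrite minorC.
  have ni0 : nrm i != 0 by rewrite gt_eqF ?arow_gt0.
  move: nij; rewrite (cauchy_schwarz _ _).2 => /eqP E.
  by rewrite mulrC -scalerA -E scalerA mulVf // scale1r.
have AE : A = (\col_j (dot (a j) (a i) / nrm i)) *m row i A.
  apply/row_matrixP => j; apply: trmx_inj.
  rewrite -/(arow A j) {1}par row_mul.
  have -> : row j (\col_k (dot (a k) (a i) / nrm i)) = (dot (a j) (a i) / nrm i)%:M.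
    by apply/matrixP => s t; rewrite !ord1 !mxE eqxx.
  by rewrite mul_scalar_mx linearZ.
have := mxrankM_maxr (\col_j (dot (a j) (a i) / nrm i)) (row i A).
rewrite -AE => /leq_trans/(_ (rank_leq_row _)).
by rewrite leqNgt rank_ge2.
Qed.

Definition pair_energy c (y : 'cV[R]_m) : R :=
  \sum_i \sum_j c i j * dot (cross y i j) (cross y i j).

(** A weighted graph Laplacian for vector-valued edges: the matrix of the
    quadratic form [pair_energy]. *)
Definition pair_mx c : 'M[R]_m :=
  \matrix_(i, j) ((\sum_l (c i l + c l i) * nrm l) *+ (i == j)
                  - (c i j + c j i) * dot (a i) (a j)).

Lemma pair_mx_sym c : (pair_mx c)^T = pair_mx c.
Proof.
apply/matrixP => i j; rewrite !mxE (dotC (a j)) (addrC (c j i)) eq_sym.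
by congr (_ - _); have [->|] := eqVneq i j.
Qed.

Lemma dot_pair_mx c y : dot y (pair_mx c *m y) = pair_energy c y.
Proof.
have -> : dot y (pair_mx c *m y)
    = (\sum_i \sum_l c i l * (y i 0 ^+ 2 * nrm l)
       + \sum_i \sum_l c l i * (y i 0 ^+ 2 * nrm l))
      - (\sum_i \sum_j c i j * (y i 0 * y j 0 * dot (a i) (a j))
         + \sum_i \sum_j c j i * (y i 0 * y j 0 * dot (a i) (a j))).
  rewrite -!big_split -sumrB; apply: eq_bigr => i _ /=.
  rewrite -!big_split /= mxE mulr_sumr.
  under [LHS]eq_bigr => j _ do rewrite mxE mulrBl mulrBr.
  rewrite sumrB; congr (_ - _); last by apply: eq_bigr => j _; ring.
  rewrite (bigD1 i) //= [X in _ + X = _]big1 => [|j ji]; last first.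
    by rewrite eq_sym (negPf ji) mulr0n mul0r mulr0.
  rewrite eqxx mulr1n addr0 mulr_suml mulr_sumr.
  by apply: eq_bigr => l _; ring.
rewrite [X in _ + X - _]exchange_big [X in _ - (_ + X)]exchange_big /=.
rewrite -!big_split -sumrB; apply: eq_bigr => i _ /=.
rewrite -!big_split -sumrB; apply: eq_bigr => j _ /=.
by rewrite /cross !dot_lin (dotC (a j) (a i)); ring.
Qed.

(** If y_i is nonzero, choose j with rows i and j independent: then
    y_i a_j - y_j a_i is nonzero and its weight is positive. *)
Lemma pair_mx_posdef c : (forall i j, 0 <= c i j) ->
  (forall i j, 0 < minor i j -> 0 < c i j) -> posdef (pair_mx c).
Proof.
move=> c0 c1 y /cV0Pn[i yi0]; have [j ij] := exists_independent i.
have term0 s t : 0 <= c s t * dot (cross y s t) (cross y s t).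
  by rewrite mulr_ge0 ?dot_ge0.
rewrite dot_pair_mx /pair_energy (bigD1 i) //= (bigD1 j) //=.
rewrite -addrA ltr_pwDl ?mulr_gt0 ?c1 ?minor_cross_gt0 //.
by rewrite addr_ge0 ?sumr_ge0 // => s _; rewrite sumr_ge0.
Qed.

Lemma sigma_min_pair_le c (e : 'cV[R]_n) :
  (forall i j, 0 <= c i j) -> (forall i j, 0 < minor i j -> 0 < c i j) ->
  (e^T <= A)%MS ->
  sigma_min (spd_sqrt (pair_mx c) *m A) ^+ 2 * norm2 e ^+ 2
    <= pair_energy c (A *m e).
Proof.
move=> c0 c1 /submxP[f eE]; rewrite norm2_sq -dot_pair_mx.
apply: (sigma_min_sqrt_le (f := f^T)); first exact: pair_mx_sym.
  exact: pair_mx_posdef.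
by apply: trmx_inj; rewrite eE trmx_mul !trmxK.
Qed.

Lemma frob_sq p (B : 'M[R]_(m, p)) :
  frob B ^+ 2 = \sum_i \sum_j B i j ^+ 2.
Proof.
rewrite sqr_sqrtr // sumr_ge0 // => i _.
by rewrite sumr_ge0 // => j _; exact: sqr_ge0.
Qed.

Lemma frob_rows : frob A ^+ 2 = \sum_i nrm i.
Proof.
rewrite frob_sq; apply: eq_bigr => i _; apply: eq_bigr => j _.
by rewrite !mxE expr2.
Qed.

Lemma frob_minus_row_gt0 i : 0 < frob A ^+ 2 - nrm i.
Proof.
have [j ij] := exists_independent i.
have ji : j != i by apply: contraTneq ij => ->; rewrite minor_diag ltxx.
rewrite frob_rows (bigD1 i) //= addrAC subrr add0r (bigD1 j) //=.
rewrite ltr_pwDl ?arow_gt0 // sumr_ge0 // => k _; exact: dot_ge0.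
Qed.

End Weights.

(** * Expected squared length of the direction *)

Section Strategies.
Context {R : realType} {m n : nat}.
Variables (A : 'M[R]_(m, n)) (b : 'cV[R]_m) (xs : 'cV[R]_n).
Hypotheses (rows_neq0 : forall i, row i A != 0) (rank_ge2 : (2 <= \rank A)%N).
Hypothesis sol : A *m xs = b.

Local Notation a := (arow A).
Local Notation nrm i := (dot (a i) (a i)).
Local Notation r x := (A *m (x - xs)).

Lemma sum_pairs (f : 'I_m * 'I_m -> R) :
  \sum_p f p = \sum_i \sum_j f (i, j).
Proof. by rewrite pair_bigA; apply: eq_bigr => -[]. Qed.

Lemma dir_w_cross x i j :
  norm2 (dir_w A b x (i, j)) ^+ 2
  = dot (cross A (r x) i j) (cross A (r x) i j) / (nrm i * nrm j).
Proof. by rewrite norm2_sq (dir_w_sq rows_neq0 sol) /= !dot_arow. Qed.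

Definition weightI (i j : 'I_m) : R := (frob A ^+ 2 - nrm i)^-1.

(** The asymmetry of M in i and j is that of the weights; [pair_mx] symmetrizes
    them, and the symmetric part of M does the same. *)
Lemma sqrtME : sqrtM A = spd_sqrt (pair_mx A weightI).
Proof.
rewrite /sqrtM; congr spd_sqrt; apply/matrixP => i j; rewrite !mxE.
rewrite eq_sym !norm2_sq; have [->|ij] := eqVneq j i; last first.
  rewrite /weightI mulr0n (dotC (a j)); field.
  by rewrite !gt_eqF ?frob_minus_row_gt0.
have -> : \sum_l (weightI i l + weightI l i) * nrm l
    = frob A ^+ 2 * weightI i i + Delta A.
  rewrite frob_rows mulr_suml /Delta -big_split; apply: eq_bigr => l _ /=.
  by rewrite mulrDl !norm2_sq mulrC (mulrC (weightI l i)).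
rewrite mulr1n /weightI; move: (Delta A) => De; field.
by rewrite gt_eqF ?frob_minus_row_gt0.
Qed.

Lemma strategyI_ge0 p : 0 <= strategyI A p.
Proof.
rewrite /strategyI !norm2_sq; case: ifP => // _.
by rewrite !mulr_ge0 ?invr_ge0 ?sqr_ge0 ?dot_ge0 // ltW // frob_minus_row_gt0.
Qed.

(** The conditional law of the second index is normalized because
    |A|_F^2 - |a_i|^2 is nonzero, a consequence of the rank hypothesis. *)
Lemma strategyI_sum_le1 : \sum_p strategyI A p <= 1.
Proof.
have -> : \sum_p strategyI A p = \sum_i nrm i / frob A ^+ 2.
  rewrite sum_pairs; apply: eq_bigr => i _.
  rewrite (bigD1 i) //= /strategyI /= eqxx add0r.
  under eq_bigr => j ji do rewrite eq_sym (negPf ji) !norm2_sq.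
  rewrite -mulr_sumr -mulr_suml.
  have -> : \sum_(j < m | j != i) nrm j = frob A ^+ 2 - nrm i.
    by rewrite frob_rows [in RHS](bigD1 i) //= addrAC subrr add0r.
  by rewrite divff ?mulr1 // gt_eqF ?frob_minus_row_gt0.
rewrite -mulr_suml -frob_rows; have [->|F0] := eqVneq (frob A ^+ 2) 0.
  by rewrite mul0r ler01.
by rewrite divff.
Qed.

(** The probability of (i, j) cancels the normalization of |w|^2 by
    |a_i|^2 |a_j|^2, and the pairs with i = j contribute zero on both sides. *)
Lemma strategyI_mean x :
  \sum_p strategyI A p * norm2 (dir_w A b x p) ^+ 2
  = pair_energy A weightI (r x) / frob A ^+ 2.
Proof.
rewrite sum_pairs /pair_energy mulr_suml; apply: eq_bigr => i _.
rewrite mulr_suml; apply: eq_bigr => j _.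
rewrite dir_w_cross /strategyI /= !norm2_sq /weightI.
have [->|ij] := eqVneq i j; first by rewrite cross_diag dot0l !(mul0r, mulr0).
have := lt0r_neq0 (arow_gt0 rows_neq0 i); have := lt0r_neq0 (arow_gt0 rows_neq0 j).
move=> nj ni; rewrite -!mulrA [in LHS]mulrC.
rewrite [RHS]mulrC.
move: (dot (cross _ _ _ _) _) ((_ - _)^-1) ((frob A ^+ 2)^-1) => C W F.
by field; apply/andP.
Qed.

Lemma strategyI_lower_bound x : ((x - xs)^T <= A)%MS ->
  sigma_min (sqrtM A *m A) ^+ 2 / frob A ^+ 2 * norm2 (x - xs) ^+ 2
  <= \sum_p strategyI A p * norm2 (dir_w A b x p) ^+ 2.
Proof.
move=> e_row; rewrite strategyI_mean mulrAC ler_wpM2r ?invr_ge0 ?sqr_ge0 //.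
rewrite sqrtME; apply: sigma_min_pair_le => // i j.
  by rewrite invr_ge0 ltW ?frob_minus_row_gt0.
by rewrite invr_gt0 frob_minus_row_gt0.
Qed.

Definition weightII (i j : 'I_m) : R := gcoef A i j / 2.

Lemma gcoefE i j : gcoef A i j = minor A i j / (nrm i * nrm j).
Proof.
rewrite /gcoef /minor !norm2_sq mulrBl divff //.
by rewrite mulf_neq0 ?gt_eqF ?arow_gt0.
Qed.

Lemma sqrtNE : sqrtN A = spd_sqrt (pair_mx A weightII).
Proof.
have gC i j : gcoef A i j = gcoef A j i.
  by rewrite !gcoefE minorC (mulrC (nrm i)).
have wE i j : weightII i j + weightII j i = gcoef A i j.
  by rewrite /weightII -(gC i j); field.
rewrite /sqrtN; congr spd_sqrt; apply/matrixP => i j; rewrite !mxE wE.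
have [->|ij] := eqVneq i j; last by rewrite mulr0n add0r.
rewrite gcoefE minor_diag !mul0r subr0 mulr1n.
by apply: eq_bigr => l _; rewrite wE norm2_sq.
Qed.

Lemma det_mx22 (B : 'M[R]_2) : \det B = B 0 0 * B 1 1 - B 0 1 * B 1 0.
Proof.
rewrite (expand_det_row _ 0) !big_ord_recl big_ord0 addr0 /cofactor !det_mx11.
rewrite !mxE /= !addn0 expr0 mul1r expr1 mulN1r mulrN.
by congr (B _ _ * B _ _ - B _ _ * B _ _); apply: val_inj.
Qed.

Lemma gram_detE i j : i != j -> gram_det A [set i; j]%SET = minor A i j.
Proof.
move=> ij.
(* The index type of [rows_in] has size #|S|, which is 2 only up to a proof, so
   the size is generalized before it is replaced by 2. *)
have gen k (f : 'I_k -> 'I_m) : k = 2%N -> injective f ->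
    (forall t, f t \in [set i; j]%SET) ->
    \det (rowsub f A *m (rowsub f A)^T) = minor A i j.
  move=> k2; move: f; rewrite k2 => f finj fS.
  have entry s t : (rowsub f A *m (rowsub f A)^T) s t = dot (a (f s)) (a (f t)).
    by rewrite !mxE; apply: eq_bigr => l _; rewrite !mxE.
  rewrite det_mx22 !entry (dotC (a (f 1))) -expr2 -/(minor A (f 0) (f 1)).
  have : f 0 != f 1 by rewrite (inj_eq finj).
  have := fS 0; have := fS 1; rewrite !inE.
  move=> /orP[]/eqP-> /orP[]/eqP-> //; rewrite ?eqxx //.
  by rewrite minorC.
apply: gen; first by rewrite cards2 ij.
  exact: enum_val_inj.
by move=> t; exact: enum_valP.
Qed.

Lemma sum_fiber (f : 'I_m * 'I_m -> R) i j : i != j ->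
  \sum_(p | [set p.1; p.2]%SET == [set i; j]%SET) f p = f (i, j) + f (j, i).
Proof.
move=> ij; rewrite (bigD1 (i, j)) //= (bigD1 (j, i)) /=; last first.
  by rewrite finset.setUC eqxx xpair_eqE negb_and eq_sym ij.
rewrite big1 ?addr0 // => -[k l] /= /andP[/andP[/eqP S n1] n2].
have k_in : k \in [set i; j]%SET by rewrite -S set21.
have l_in : l \in [set i; j]%SET by rewrite -S set22.
have i_in : i \in [set k; l]%SET by rewrite S set21.
have j_in : j \in [set k; l]%SET by rewrite S set22.
move: k_in l_in i_in j_in n1 n2 ij; rewrite !inE !xpair_eqE.
by do 4![case: eqVneq => //= ?]; subst; rewrite ?eqxx.
Qed.

(** Grouping ordered pairs by the unordered pair that they label is what connects
    the law on labelled pairs with volume sampling. *)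
Lemma sum_offdiag (f : 'I_m * 'I_m -> R) :
  \sum_(p | p.1 != p.2) f p
  = \sum_(S : {set 'I_m} | #|S| == 2%N)
      \sum_(p | [set p.1; p.2]%SET == S) f p.
Proof.
rewrite (partition_big (fun p => [set p.1; p.2]%SET)
                       (fun S : {set 'I_m} => #|S| == 2%N)) /=.
  apply: eq_bigr => S /eqP S2; apply: eq_bigl => p.
  apply: andb_idl => /eqP SE; move: S2; rewrite -SE cards2.
  by case: eqP.
by move=> p ne; rewrite cards2 ne.
Qed.

Lemma sum_offdiag_all (f : 'I_m * 'I_m -> R) : (forall i, f (i, i) = 0) ->
  \sum_(p | p.1 != p.2) f p = \sum_p f p.
Proof.
move=> f0; rewrite [RHS](bigID (fun p : 'I_m * 'I_m => p.1 != p.2)) /=.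
rewrite [X in _ = _ + X]big1 ?addr0 // => -[i j] /=.
by rewrite negbK => /eqP ->.
Qed.

(** By [total_minorE] this is the sum of the Gram determinants over ordered pairs,
    twice the normalizing constant of volume sampling. *)
Definition total_minor : R := frob A ^+ 4 - frob (A *m A^T) ^+ 2.

Lemma total_minorE : total_minor = \sum_(p | p.1 != p.2) minor A p.1 p.2.
Proof.
rewrite sum_offdiag_all => [|i]; last exact: minor_diag.
rewrite sum_pairs /total_minor /= (exprM _ 2 2) frob_rows frob_sq.
rewrite [X in X - _]expr2 mulr_suml -sumrB; apply: eq_bigr => i _.
rewrite mulr_sumr -sumrB; apply: eq_bigr => j _ /=.
congr (_ - _ ^+ 2); rewrite mxE.
by apply: eq_bigr => k _; rewrite !mxE.
Qed.

Lemma sum_gram_det :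
  \sum_(J : {set 'I_m} | #|J| == 2%N) gram_det A J = total_minor / 2.
Proof.
rewrite total_minorE sum_offdiag mulr_suml; apply: eq_bigr => S.
move=> /cards2P[i [j [ij ->]]].
rewrite gram_detE // (sum_fiber (fun p => minor A p.1 p.2)) //= (minorC A j).
by field.
Qed.

(** The length of w does not depend on the order of the two reflections, so only
    the law of the unordered pair matters, whatever the labelling rule. Only an
    inequality is claimed: pairs with i = j are dropped as nonnegative terms
    instead of being shown to have probability zero. *)
Lemma strategyII_mean q x : strategyII A q ->
  2 * pair_energy A weightII (r x) / total_minor
  <= \sum_p q p * norm2 (dir_w A b x p) ^+ 2.
Proof.
move=> [q0 _ qS]; pose h i j := norm2 (dir_w A b x (i, j)) ^+ 2.
have hC i j : h i j = h j i.
  rewrite /h !dir_w_cross (mulrC (nrm i)) crossC.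
  by rewrite !dot_lin opprK.
apply: (@le_trans _ _ (\sum_(p | p.1 != p.2) q p * h p.1 p.2)); last first.
  rewrite [leRHS](bigID (fun p : 'I_m * 'I_m => p.1 != p.2)) /=.
  rewrite (eq_bigr (fun p => q p * norm2 (dir_w A b x p) ^+ 2)) => [|[i j] //].
  by rewrite lerDl sumr_ge0 // => p _; rewrite mulr_ge0 // sqr_ge0.
have -> : 2 * pair_energy A weightII (r x)
    = \sum_(p | p.1 != p.2) minor A p.1 p.2 * h p.1 p.2.
  rewrite sum_offdiag_all => [|i]; last by rewrite minor_diag mul0r.
  rewrite sum_pairs mulr_sumr; apply: eq_bigr => i _.
  rewrite mulr_sumr; apply: eq_bigr => j _.
  rewrite /h dir_w_cross /weightII gcoefE /=; field.
  by rewrite !gt_eqF ?arow_gt0.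
rewrite !sum_offdiag mulr_suml; apply: ler_sum => S.
move=> /cards2P[i [j [ij SE]]]; rewrite SE.
rewrite (sum_fiber (fun p => minor A p.1 p.2 * h p.1 p.2)) //=.
rewrite (sum_fiber (fun p => q p * h p.1 p.2)) //= -(hC i j) (minorC A j).
have := qS [set i; j]%SET; rewrite cards2 ij => /(_ erefl).
rewrite (sum_fiber q ij) /volume_prob sum_gram_det gram_detE // -[leRHS]mulrDl => ->.
by rewrite invfM invrK le_eqVlt; apply/orP; left; apply/eqP; ring.
Qed.

Lemma strategyII_lower_bound q x : strategyII A q -> ((x - xs)^T <= A)%MS ->
  2 * (sigma_min (sqrtN A *m A) ^+ 2 / (frob A ^+ 4 - frob (A *m A^T) ^+ 2))
    * norm2 (x - xs) ^+ 2
  <= \sum_p q p * norm2 (dir_w A b x p) ^+ 2.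
Proof.
move=> qII e_row; apply: le_trans (strategyII_mean x qII).
rewrite -/total_minor mulrA mulrAC ler_wpM2r //.
  by rewrite invr_ge0 total_minorE sumr_ge0 // => p _; exact: minor_ge0.
rewrite -mulrA ler_wpM2l ?ler0n // sqrtNE.
apply: sigma_min_pair_le => // i j.
  by rewrite /weightII gcoefE !divr_ge0 ?mulr_ge0 ?minor_ge0 ?dot_ge0.
by move=> ij; rewrite /weightII gcoefE !divr_gt0 ?mulr_gt0 ?arow_gt0.
Qed.

End Strategies.

(** * The limit point and the theorem *)

Section Solution.
Context {R : realType} {m n : nat}.
Variables (A : 'M[R]_(m, n)) (b : 'cV[R]_m) (x0 : 'cV[R]_n).
Hypothesis consistent : exists x, A *m x = b.

Lemma xstar_sol : A *m xstar A b x0 = b.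
Proof.
have [AXA _ _ _] := mp_pinvP A; have [y <-] := consistent.
rewrite /xstar mulmxDr !mulmxA mulmxBr mulmx1 !mulmxA AXA subrr mul0mx addr0.
by [].
Qed.

(** Since X = X A X and X A is symmetric, the range of the pseudoinverse X is in
    the row space of A. *)
Lemma xstar_row : ((x0 - xstar A b x0)^T <= A)%MS.
Proof.
have [_ XAX _ XAsym] := mp_pinvP A; set X := mp_pinv A in XAX XAsym.
have -> : x0 - xstar A b x0 = X *m (A *m x0 - b).
  by rewrite /xstar -/X mulmxBl mul1mx mulmxBr mulmxA opprD opprB addrCA
    (addrC (_ *m x0)) addNKr addrC.
rewrite -XAX -XAsym !trmx_mul !trmxK !mulmxA.
exact: submxMl.
Qed.

End Solution.

Theorem theorem4p3 (R : realType) (m n : nat) (A : 'M[R]_(m, n))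
    (b : 'cV[R]_m) (x0 : 'cV[R]_n)
    (rows_neq0 : forall i : 'I_m, row i A != 0)
    (rank_ge2 : (2 <= \rank A)%N)
    (consistent : exists x : 'cV[R]_n, A *m x = b) :
  let xs := xstar A b x0 in
  (forall (x : nat -> 'cV[R]_n) (k : nat), (1 <= k)%N ->
     AmPRDR_run A b (fun=> strategyI A) x0 k x ->
     A *m x k <> b ->
     accepted_expectation A b (strategyI A) (x k)
       (fun p => norm2 (next_iterate A b (x k.-1) (x k) p - xs) ^+ 2)
     <= (1 - gamma A b xs (x k.-1) (x k))
        * (1 - sigma_min (sqrtM A *m A) ^+ 2 / frob A ^+ 2)
        * norm2 (x k - xs) ^+ 2)
  /\
  (forall (q : nat -> 'I_m * 'I_m -> R), (forall t, strategyII A (q t)) ->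
   forall (x : nat -> 'cV[R]_n) (k : nat), (1 <= k)%N ->
     AmPRDR_run A b q x0 k x ->
     A *m x k <> b ->
     accepted_expectation A b (q k) (x k)
       (fun p => norm2 (next_iterate A b (x k.-1) (x k) p - xs) ^+ 2)
     <= (1 - gamma A b xs (x k.-1) (x k))
        * (1 - 2 * (sigma_min (sqrtN A *m A) ^+ 2
                    / (frob A ^+ 4 - frob (A *m A^T) ^+ 2)))
        * norm2 (x k - xs) ^+ 2).
Proof.
move=> xs.
have sol : A *m xs = b := xstar_sol x0 consistent.
have step law x k : (1 <= k)%N -> AmPRDR_run A b law x0 k x ->
    regular_step A xs (x k.-1) (x k) /\ ((x k - xs)^T <= A)%MS.
  case: k => // k _ run; split; first exact: (run_regular rows_neq0 sol run).
  rewrite -(subrK x0 (x k.+1)) -addrA linearD addmx_sub //.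
    exact: (run_rowspace rows_neq0 sol run).
  exact: xstar_row.
split=> [x k k1 run _|q qII x k k1 run _].
  have [[_ moved orth] e_row] := step _ _ _ k1 run.
  apply: expectation_le => //.
  - exact: strategyI_ge0.
  - exact: strategyI_sum_le1.
  - exact: strategyI_lower_bound.
have [[_ moved orth] e_row] := step _ _ _ k1 run.
have [q0 q1 _] := qII k.
apply: expectation_le => //; first by rewrite q1.
exact: strategyII_lower_bound.
Qed.
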